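(* Let $\Psi: \{1,\dots,7\} \to \mathbb{Z}_{>0}$ be a function such that for every $j \in \{1,\dots,7\}$, every $n \geq \Psi(j)$ and every transitive subgroup $H$ of $S_n$ with $H \neq A_n$ and $H \neq S_n$, one has $m(H) \leq n - j$. Let $1 \leq k \leq 5$ be an integer and let $n$ be a natural number with $n \geq \max\{\Psi(k+2), 3k+3\}$. Then $$\iota_{n-k}(S_n) = \{x \in S_n : d(x) \leq k\} \cup \{x \in S_n : x \text{ is an even permutation},\ d(x) = k+1,\ k \text{ odd}\}$$ (so the second set is empty when $k$ is even).
   Context: For a finite group $G$, a set $\{g_1,\dots,g_r\}$ of elements of $G$ is irredundant if for every $j$ the subgroup $\langle g_i : i \neq j\rangle$ is different from $\langle g_1,\dots,g_r\rangle$; it is an irredundant generating set of $G$ if moreover it generates $G$. $m(G)$ denotes the maximal size of an irredundant generating set of $G$. $\iota_r(G)$ denotes the set of elements of $G$ that lie in some irredundant generating set of size $r$ of $G$. For a cycle $c = (u_1\,u_2\,\dots\,u_s) \in S_n$ put $d(c) = s-1$; for $x \in S_n$ with disjoint cycle decomposition $x = c_1 c_2 \cdots c_p$ put $d(x) = \sum_{i=1}^p d(c_i)$.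
   Formalization: The identity is removed from the right-hand side: d(1) = 0 ≤ k, but the identity lies in no irredundant set, so it never belongs to ι_{n-k}(S_n) and the printed equality fails exactly at x = 1. *)

(* Defs.v *)
From mathcomp Require Import all_boot all_fingroup all_solvable.

Set Implicit Arguments.
Unset Strict Implicit.
Unset Printing Implicit Defensive.

Local Open Scope group_scope.

(* Families g_1, ..., g_r are rendered as sets: a family with a repetition is
   never irredundant, since either copy can be dropped. *)
Definition irredundant (gT : finGroupType) (A : {set gT}) : bool :=
  [forall g in A, <<A :\ g>> != <<A>>].

Definition irredundant_gen (gT : finGroupType) (G A : {set gT}) : bool :=
  irredundant A && (<<A>> == G).

Definition max_irredundant_gen (gT : finGroupType) (G : {group gT}) : nat :=
  \max_(A : {set gT} | irredundant_gen G A) #|A|.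

Definition iota_irr (gT : finGroupType) (r : nat) (G : {group gT}) : {set gT} :=
  [set x in G | [exists A : {set gT},
     [&& irredundant_gen G A, #|A| == r & x \in A]]].

(* The elements of porbits x are the supports of the disjoint cycles of x,
   together with the singletons of fixed points, which contribute 0. *)
Definition cycle_defect (T : finType) (x : {perm T}) : nat :=
  \sum_(C in porbits x) #|C|.-1.

(* Consequently the identity belongs to no iota_irr r G, although its
   cycle_defect is 0. *)
Lemma irredundant_notin1 (gT : finGroupType) (A : {set gT}) :
  irredundant A -> 1 \notin A.
Proof.
move=> /forall_inP irrA; apply/negP => A1.
by have := irrA 1 A1; rewrite genD1 ?group1 // eqxx.
Qed.

(* Main.v *)
Require Import Defs.
From mathcomp Require Import all_boot all_fingroup all_solvable.
From mathcomp Require Import zify.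

Set Implicit Arguments.
Unset Strict Implicit.
Unset Printing Implicit Defensive.

Local Open Scope group_scope.

(** Write d(x) for [cycle_defect x] and n for the size of the permuted set;
x has n - d(x) cycles.

Upper bound on d(x).  Let A be an irredundant generating set of the symmetric
group with n - k elements.  For g in A, the group <A - g> is proper and has an
irredundant generating set of n - k - 1 elements, so the hypothesis on
transitive groups leaves two cases: <A - g> is intransitive or equal to the
alternating group.  If <A - b> is intransitive for every b <> x in A, add the
elements of A to <x> one at a time: every step must merge two orbits, for an
element b that merges nothing would already preserve the orbits of <A - b>,
and these would then be the orbits of <A>.  Starting from n - d(x) orbits,
n - k - 1 steps end with at least one orbit, so d(x) <= k
([defect_transitive]).  Otherwise <A - g> is alternating for some g <> x.
Then all elements of A but g are even, g is odd, and no <A - b> with b <> g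
can be alternating; the same count applied to A - g gives d(x) <= k + 1.
As x is even, so is d(x), and d(x) = k + 1 forces k to be odd
([cycle_defect_iota_irr]).

Constructions.  Choose a set X of representatives of the cycles of x.  The
number of fixed points of x is at least n - 2 d(x).  If x <> 1 and d(x) <= k,
let y be a cycle of length k - d(x) + 2 on fixed points of x, one of which is
f: then x, y and the transpositions (f z), for z in X outside the cycle y,
generate and are irredundant, and there are n - k of them
([iota_irr_defect_le]).  If x <> 1 is even and d(x) = k + 1, choose u in X
moved by x, and take x, the transposition (u x(u)) and the 3-cycles through
u, x(u) and z, for z in X - u; the transposition is needed because all the
other elements are even ([iota_irr_even]).  In all the other cases, removing
an element leaves a proper subset invariant. *)

(** * Irredundant sets and cycles of a permutation *)

Lemma irredundantD1 (gT : finGroupType) (A : {set gT}) (g : gT) :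
  irredundant A -> g \in A -> irredundant (A :\ g).
Proof.
move=> /forall_inP irrA Ag; apply/forall_inP => h /setD1P[hg Ah].
apply: contraNneq (irrA h Ah) => e.
have AhS : A :\ g :\ h \subset A :\ h by rewrite setSD ?subsetDl.
rewrite eqEsubset genS ?subsetDl //= gen_subG; apply/subsetP => a Aa.
have [->|ah] := eqVneq a h; last by rewrite mem_gen // !inE ah.
by apply: (subsetP (genS AhS)); rewrite e mem_gen // !inE hg.
Qed.

Lemma porbitsE (T : finType) (x : {perm T}) :
  porbits x = orbit 'P <[x]> @: [set: T].
Proof.
apply/setP => C; apply/imsetP/imsetP => -[i _ ->]; exists i => //;
  by rewrite porbit.unlock.
Qed.

Lemma porbits_partition (T : finType) (x : {perm T}) :
  partition (porbits x) [set: T].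
Proof.
rewrite porbitsE; apply: orbit_partition.
by apply/actsP => a _ i; rewrite !inE.
Qed.

Lemma cycle_defect_porbits (T : finType) (x : {perm T}) :
  (cycle_defect x + #|porbits x| = #|T|)%N.
Proof.
rewrite -cardsT (card_partition (porbits_partition x)) -sum1_card -big_split /=.
by apply: eq_bigr => C /imsetP[i _ ->]; rewrite addn1 prednK // lt0n card_porbit_neq0.
Qed.

Lemma odd_cycle_defect (T : finType) (x : {perm T}) :
  odd (cycle_defect x) = odd_perm x.
Proof. by rewrite /odd_perm -(cycle_defect_porbits x) oddD -addbA addbb addbF. Qed.

(** Representatives of the cycles, described through [porbit] alone so that
blocks of partitions do not appear in the constructions. *)
Lemma porbits_transversal (T : finType) (x : {perm T}) :
  exists X : {set T}, [/\ #|X| = #|porbits x|,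
    forall w, exists2 z, z \in X & w \in porbit x z
  & {in X &, forall z w, w \in porbit x z -> w = z}].
Proof.
have pP := porbits_partition x; have tP := transversalP pP.
set X := transversal _ _ in tP; exists X; split.
- exact: card_transversal tP.
- move=> w; have Pw : porbit x w \in porbits x by exact: imset_f.
  exists (transversal_repr w X (porbit x w)).
    exact: (repr_mem_transversal tP).
  by rewrite porbit_sym (repr_mem_pblock tP).
- have tI := partition_trivIset pP.
  have pb i : pblock (porbits x) i = porbit x i.
    by rewrite (def_pblock tI _ (porbit_id x i)) // imset_f.
  move=> z w Xz Xw; rewrite -eq_porbit_mem -!pb => /eqP.
  exact: (pblock_inj tP).
Qed.

(** A nontrivial cycle C satisfies #|C| <= 2 (#|C| - 1), so at most 2 d(x)
points are moved. *)
Lemma card_fixpoints (T : finType) (x : {perm T}) :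
  (#|T| <= #|[set i | x i == i]| + (cycle_defect x).*2)%N.
Proof.
set F := [set i | _].
pose S := [set C in porbits x | #|C| == 1%N].
have le_SF : (#|S| <= #|F|)%N.
  apply: leq_trans (leq_imset_card (fun i => [set i]) F).
  apply/subset_leq_card/subsetP => C; rewrite !inE => /andP[/imsetP[i _ ->] /cards1P[j e]].
  have ij : i = j by apply/set1P; rewrite -e porbit_id.
  rewrite e imset_f // inE; have := mem_porbit x 1 i.
  by rewrite e expg1 ij inE.
apply: leq_trans (leq_add le_SF (leqnn _)).
have -> : #|S| = (\sum_(C in porbits x) (#|C| == 1))%N.
  rewrite -sum1_card (eq_bigl _ _ (in_set _)) big_mkcondr /=.
  by apply: eq_bigr => C _; case: eqP.
rewrite -cardsT (card_partition (porbits_partition x)) -mul2n big_distrr /=.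
rewrite -big_split /=; apply: leq_sum => C /imsetP[i _ ->].
by case: #|_| => [|[|m]] //=; rewrite mul2n doubleS !ltnS -addnn leq_addr.
Qed.

(** * Generating and failing to generate the symmetric group *)

Lemma Sym_gen_star (T : finType) (H : {group {perm T}}) (f : T) :
  (forall w, tperm f w \in H) -> H = [set: {perm T}] :> {set _}.
Proof.
move=> fH; apply/eqP; rewrite eqEsubset subsetT /= -(gen_tperm f) gen_subG.
by apply/subsetP => _ /imsetP[w _ ->].
Qed.

(** The certificate of irredundance in both constructions: all elements but one
preserve a set C that is neither empty nor full. *)
Lemma stab_gen_neq_Sym (T : finType) (A : {set {perm T}}) (C : {set T}) (i j : T) :
  i \in C -> j \notin C -> {in A, forall a : {perm T}, {in C, forall w, a w \in C}} ->
  <<A>> != [set: {perm T}].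
Proof.
move=> Ci Cj AC; apply: contraNneq Cj => eA.
have /subsetP/(_ (tperm i j)) : <<A>> \subset 'N(C | 'P).
  rewrite gen_subG; apply/subsetP => a Aa; rewrite !inE.
  by apply/subsetP => w Cw; rewrite inE /= apermE AC.
rewrite eA => /(_ (in_setT _)) /astabsP /(_ i) /esym.
by rewrite Ci /= apermE tpermL.
Qed.

(** * Counting orbits along a chain of subgroups *)

Lemma orbit_gen_sub (T : finType) (A : {set {perm T}}) (K : {group {perm T}}) (i : T) :
  {in A, forall a : {perm T}, forall w, a w \in orbit 'P K w} ->
  orbit 'P <<A>> i \subset orbit 'P K i.
Proof.
move=> AK; apply/subsetP => _ /imsetP[a Aa ->].
have: a \in 'N(orbit 'P K i | 'P).
  apply: subsetP Aa; rewrite gen_subG; apply/subsetP => b Ab; rewrite !inE.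
  apply/subsetP => w iw; rewrite inE /= apermE.
  by rewrite -(orbit_eqP iw) AK.
by move/astabsP => ->; rewrite orbit_refl.
Qed.

(** Mapping the H-orbit of w to its G-orbit is onto, and it is not injective
because i and b i have the same image. *)
Lemma card_orbits_lt (T : finType) (H G : {group {perm T}}) (b : {perm T}) (i : T) :
  H \subset G -> b \in G -> b i \notin orbit 'P H i ->
  (#|orbit 'P G @: [set: T]| < #|orbit 'P H @: [set: T]|)%N.
Proof.
move=> sHG Gb bi.
have Hsub w : orbit 'P H w \subset orbit 'P G w by apply: imsetS.
pose f (C : {set T}) := if [pick w in C] is Some w then orbit 'P G w else set0.
have fE w : f (orbit 'P H w) = orbit 'P G w.
  rewrite /f; case: pickP => [z wz|/(_ w)]; last by rewrite orbit_refl.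
  by apply/orbit_eqP; apply: (subsetP (Hsub w)).
have -> : orbit 'P G @: [set: T] = f @: (orbit 'P H @: [set: T]).
  by rewrite -imset_comp; apply: eq_imset => w; rewrite /= fE.
rewrite ltn_neqAle leq_imset_card andbT; apply: contra bi => /imset_injP inj_f.
rewrite -orbit_eq_mem; apply/eqP; apply: inj_f; rewrite ?imset_f // !fE.
by apply/orbit_eqP/imsetP; exists b.
Qed.

(** Each element of A other than x, when added to the elements already present,
merges two orbits; hence #|A| - 1 is at most the number of cycles of x
minus 1. *)
Lemma defect_transitive (T : finType) (A : {set {perm T}}) (x : {perm T}) :
  x \in A -> [transitive <<A>>, on [set: T] | 'P] ->
  {in A, forall b, b != x -> ~~ [transitive <<A :\ b>>, on [set: T] | 'P]} ->
  (cycle_defect x + #|A| <= #|T|)%N.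
Proof.
move=> Ax trA ntrA.
(* If b preserved every orbit of <<A :\ b>>, then these would be the orbits
   of <<A>>, and <<A :\ b>> would be transitive. *)
have moved b : b \in A -> b != x -> exists i, b i \notin orbit 'P <<A :\ b>> i.
  move=> Ab bx; apply/existsP; apply: contraNT (ntrA b Ab bx) => /existsPn fix_b.
  have [i _ _] := imsetP trA; apply/imsetP; exists i => //.
  apply/esym/eqP; rewrite -subTset -(atransP trA i) ?in_setT //.
  apply: orbit_gen_sub => a Aa w.
  have [->|ab] := eqVneq a b; first by have := fix_b w; rewrite negbK.
  by rewrite -apermE mem_orbit // mem_gen // !inE ab.
have chain m (D : {set {perm T}}) : D \subset A :\ x -> #|D| = m ->
    (m + #|orbit 'P <<x |: D>> @: [set: T]| <= #|porbits x|)%N.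
  elim: m D => [|m IHm] D sDA cD.
    by rewrite (cards0_eq cD) setU0 porbitsE.
  have /card_gt0P[b Db] : (0 < #|D|)%N by rewrite cD.
  have /setD1P[bx Ab] := subsetP sDA b Db.
  have [i bi] := moved b Ab bx.
  have sDbA : D :\ b \subset A :\ x by apply: subset_trans sDA; apply: subsetDl.
  apply: leq_trans (IHm _ sDbA _); last first.
    by move: cD; rewrite (cardsD1 b) Db => -[].
  rewrite addSn -addnS leq_add2l.
  apply: (@card_orbits_lt _ <<x |: D :\ b>>%G <<x |: D>>%G b i).
  - by rewrite genS // setUS // subsetDl.
  - by rewrite mem_gen // !inE Db orbT.
  - apply: contra bi; apply/subsetP/imsetS/genS/subsetP => a.
    rewrite !inE => /predU1P[->|/andP[-> /(subsetP sDA)/setD1P[] //]].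
    by rewrite eq_sym bx.
have := chain _ _ (subxx (A :\ x)) (erefl _).
rewrite setD1K // -(cycle_defect_porbits x) (cardsD1 x A) Ax => le_ch.
rewrite leq_add2l; apply: leq_trans le_ch.
rewrite addnC leq_add2l card_gt0; apply/set0Pn.
by exists [set: T]; exact: trA.
Qed.

(** * Irredundant generating sets containing a given permutation *)

Lemma irredundant_gen_iota (gT : finGroupType) (G : {group gT}) (A : {set gT}) x :
  <<A>> = G -> {in A, forall a, <<A :\ a>> != G} -> x \in A ->
  x \in iota_irr #|A| G.
Proof.
move=> genA irrA Ax; rewrite inE -{1}genA mem_gen //=; apply/existsP; exists A.
rewrite eqxx Ax /irredundant_gen genA eqxx !andbT; apply/forall_inP => a Aa.
by rewrite genA irrA.
Qed.

(** As x fixes f, conjugating (f z) by powers of x gives (f w) for every w in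
the cycle of z. *)
Lemma Sym_gen_transversal (T : finType) (H : {group {perm T}}) (x : {perm T})
    (X : {set T}) (f : T) :
  x \in H -> x f = f -> (forall w, exists2 z, z \in X & w \in porbit x z) ->
  {in X, forall z, tperm f z \in H} -> H = [set: {perm T}] :> {set _}.
Proof.
move=> Hx xf coverX HX; apply: (@Sym_gen_star _ _ f) => w.
have [z Xz /porbitP[i ->]] := coverX w.
by rewrite -{1}(permX_fix i xf) -tpermJ groupJ ?groupX // HX.
Qed.

Lemma perm_mem_porbit (T : finType) (x : {perm T}) z w :
  w \in porbit x z -> x w \in porbit x z.
Proof. by case/porbitP=> i ->; rewrite -permM -expgSr mem_porbit. Qed.

Lemma transversal_fix (T : finType) (x : {perm T}) (X : {set T}) p :
  (forall w, exists2 z, z \in X & w \in porbit x z) -> x p = p -> p \in X.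
Proof.
move=> coverX xp; have [z Xz] := coverX p.
by rewrite porbit_sym => /porbitP[i ez]; rewrite -(permX_fix i xp) -ez.
Qed.

Lemma transversal_moved (T : finType) (x : {perm T}) (X : {set T}) :
  (forall w, exists2 z, z \in X & w \in porbit x z) -> x != 1 ->
  exists2 u, u \in X & x u != u.
Proof.
move=> coverX x1; apply/exists_inP; apply: contraNT x1 => /exists_inPn fixX.
apply/eqP/permP => w; rewrite perm1.
have [z /fixX/negPn/eqP xz /porbitP[i ->]] := coverX w.
by rewrite permX_fix.
Qed.

(** The cycle y exists to adjust the size: the set with transpositions only has
n - d(x) elements, and replacing k - d(x) + 1 transpositions (f p) by one cycle
on f and the points p removes k - d(x) of them without losing transitivity. *)
Lemma iota_irr_defect_le (T : finType) (k : nat) (x : {perm T}) :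
  x != 1 -> (cycle_defect x <= k)%N -> (cycle_defect x + k + 2 <= #|T|)%N ->
  x \in iota_irr (#|T| - k) [set: {perm T}]%G.
Proof.
move=> x1 le_dk le_n.
have [X [cX coverX transX]] := porbits_transversal x.
(* s lists the points of the cycle y; it has at least two entries even when
   d(x) = k, so that y <> 1. *)
have : ((k - cycle_defect x).+2 <= #|[set i | x i == i]|)%N.
  by have := card_fixpoints x; lia.
case/card_geqP=> s [Us sz_s fix_s].
have xs p : p \in s -> x p = p by move/fix_s; rewrite inE => /eqP.
have sX p : p \in s -> p \in X by move/xs; apply: transversal_fix coverX.
pose y := perm (can_inj (prev_next Us)).
have yE p : y p = next s p by rewrite permE.
have yN p : p \notin s -> y p = p by rewrite yE next_nth => /negPf->.
have [f [f1 [s' def_s]]] : exists f f1 s', s = [:: f, f1 & s'].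
  by case: (s) sz_s => [|f [|f1 s']] // _; exists f, f1, s'.
have fs : f \in s by rewrite def_s mem_head.
have f1s : f1 \in s by rewrite def_s !inE eqxx orbT.
have f1f : f1 != f.
  by have := Us; rewrite def_s /= inE negb_or eq_sym => /andP[/andP[]].
have yf : y f = f1 by rewrite yE def_s /= eqxx.
have ycycle p : p \in s -> exists i, (y ^+ i) f = p.
  move=> ps; have cyc : fcycle y s by rewrite (eq_fcycle yE) cycle_next.
  have := fconnect_cycle cyc fs p; rewrite ps => /iter_findex yp.
  by exists (findex y f p); rewrite permX.
have [u Xu xu] := transversal_moved coverX x1.
have us : u \notin s by apply: contraNN xu => /xs ->.
have fu : f != u by apply: contraNneq us => <-.
pose S := [set tperm f z | z in X :\: [set p in s]].
have inS a : a \in S -> exists z, [/\ z \in X, z \notin s, f != z & a = tperm f z].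
  case/imsetP=> z; rewrite !inE => /andP[zs Xz] ->; exists z; split => //.
  by apply: contraNneq zs => <-.
have yS : y \notin S.
  apply/negP => /inS[z [_ zs fz /permP/(_ z)]].
  by rewrite yN // tpermR => zf; rewrite zf eqxx in fz.
have xA : x \notin y |: S.
  rewrite !inE negb_or; apply/andP; split.
    by apply/eqP => /permP/(_ f); rewrite yf (xs f fs) => /esym/eqP; rewrite (negPf f1f).
  apply/negP => /inS[z [_ _ fz /permP/(_ f)]].
  by rewrite tpermL (xs f fs) => /eqP; rewrite (negPf fz).
have cA : #|x |: (y |: S)| = (#|T| - k)%N.
  rewrite !cardsU1 xA yS card_in_imset; last first.
    by move=> z w _ _ /permP/(_ f); rewrite !tpermL.
  have := cycle_defect_porbits x; rewrite -cX -(cardsID [set p in s] X).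
  have /setIidPr -> : [set p in s] \subset X by apply/subsetP => p; rewrite inE; apply: sX.
  have -> : #|[set p in s]| = size s by rewrite cardsE; apply/card_uniqP.
  by rewrite sz_s; lia.
rewrite -cA; apply: irredundant_gen_iota; last by rewrite setU11.
- pose H := <<x |: (y |: S)>>%G.
  have Hx : x \in H by rewrite mem_gen // setU11.
  have Hy : y \in H by rewrite mem_gen // !inE eqxx orbT.
  have HS z : z \in X -> z \notin s -> tperm f z \in H.
    move=> Xz zs; rewrite mem_gen // !in_setU.
    by rewrite [_ \in S](imset_f (tperm f)) ?orbT // !inE zs.
  apply: (@Sym_gen_transversal _ H _ _ _ Hx (xs f fs) coverX) => z Xz.
  have [zs|] := boolP (z \in s); last exact: HS.
  have [<-|fz] := eqVneq f z; first by rewrite tperm1 group1.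
  have [i yz] := ycycle z zs.
  (* u links the points of s: conjugating (f u) by powers of y gives (z u), and
     conjugating (f u) by (z u) gives (f z). *)
  have Hzu : tperm z u \in H.
    by rewrite -yz -{1}(permX_fix i (yN u us)) -tpermJ groupJ ?groupX ?HS.
  have -> : tperm f z = tperm f u ^ tperm z u.
    by rewrite tpermJ tpermR tpermD // eq_sym.
  by rewrite groupJ ?HS.
- move=> a /setU1P[->|/setU1P[->|/inS[z [Xz zs fz ->]]]].
  (* Without x, the second point of a nontrivial cycle of x is fixed. *)
  + pose w := x u.
    have wX : w \notin X.
      by apply: contra xu => Xw; apply/eqP; apply: transX => //; exact: (mem_porbit x 1).
    have ws : w \notin s by apply: contra wX; apply: sX.
    apply: (@stab_gen_neq_Sym _ _ [set w] w f); rewrite ?inE //.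
      by apply: contraNneq ws => <-.
    move=> a0 /setD1P[ax /setU1P[/eqP|]]; first by rewrite (negPf ax).
    move=> Aa _ /set1P->; case/setU1P: Aa => [->|/inS[z [Xz zs fz ->]]].
      by rewrite inE yN.
    rewrite inE tpermD //; first by apply: contraNneq ws => <-.
    by apply: contraNneq wX => <-.
  (* Without y, the point of s following f is fixed. *)
  + apply: (@stab_gen_neq_Sym _ _ [set f1] f1 f); rewrite ?inE // 1?eq_sym //.
    move=> a0 /setD1P[ay /setU1P[->|/setU1P[ey|/inS[z [Xz zs fz ->]]]]] _ /set1P->.
    * by rewrite inE xs.
    * by rewrite ey eqxx in ay.
    * rewrite inE tpermD // 1?eq_sym //.
      by apply: contraNneq zs => <-.
  (* Without (f z), the cycle of x through z is invariant. *)
  + have sC w : w \in porbit x z -> w \notin s.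
      by apply: contraL => /[dup] ws /xs xw; apply: contra zs; rewrite porbit_sym
        => /porbitP[i ->]; rewrite permX_fix.
    apply: (@stab_gen_neq_Sym _ _ (porbit x z) z f); rewrite ?porbit_id //.
      by apply: contraL fs; apply: sC.
    move=> a0 /setD1P[az /setU1P[->|/setU1P[->|/inS[z' [Xz' zs' fz' ea]]]]] w zw.
    * exact: perm_mem_porbit.
    * by rewrite yN ?sC.
    * rewrite ea tpermD //.
        by apply: contraTneq zw => <-; apply: contraL fs; apply: sC.
      apply: contraNneq az => e; rewrite ea e.
      by rewrite (transX z w) // -e.
Qed.

(** A 3-cycle through u and x(u) has defect 2, yet it joins only one new cycle
of x to that of u.  So x and even elements form a tree of n - d(x) elements, as
x and transpositions would do, and parity allows one more, the odd
transposition (u x(u)), which merges nothing. *)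
Lemma iota_irr_even (T : finType) (x : {perm T}) :
  x != 1 -> ~~ odd_perm x -> ((cycle_defect x).*2 < #|T|)%N ->
  x \in iota_irr (#|T| - cycle_defect x).+1 [set: {perm T}]%G.
Proof.
move=> x1 x_even lt_n.
have [X [cX coverX transX]] := porbits_transversal x.
have /card_gt0P[f] : (0 < #|[set i | x i == i]|)%N.
  by have := card_fixpoints x; lia.
rewrite inE => /eqP xf.
have Xf : f \in X by apply: transversal_fix coverX xf.
have [u Xu xu] := transversal_moved coverX x1; pose v := x u.
have uv : u != v by rewrite eq_sym.
have uCv : v \in porbit x u by exact: (mem_porbit x 1).
have vX : v \notin X by apply: contra xu => Xv; apply/eqP; apply: transX.
have fu : f != u by apply: contraNneq xu => <-; rewrite xf.
(* As x is even and not 1, d(x) >= 2, so X and v do not exhaust the points;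
   w is fixed by every element of the set but x. *)
have [w wX wv] : exists2 w, w \notin X & w != v.
  have d_gt1 : (1 < cycle_defect x)%N.
    have dX : (#|X| < #|T|)%N.
      rewrite -cardsT; apply/proper_card/properP; split; first exact: subsetT.
      by exists v; rewrite ?inE.
    have := odd_cycle_defect x; have := cycle_defect_porbits x.
    by rewrite (negPf x_even) -cX; case: (cycle_defect x) => [|[]] //; lia.
  have: (0 < #|~: (v |: X)|)%N.
    have := cardsC (v |: X); have := cycle_defect_porbits x.
    by rewrite cardsU1 vX -cX; lia.
  case/card_gt0P=> w; rewrite !inE negb_or => /andP[wv wX]; by exists w.
have wu : w != u by apply: contraNneq wX => ->.
pose c z := tperm u v * tperm u z.
pose S := [set c z | z in X :\ u].
have inS a : a \in S -> exists z, [/\ z \in X, z != u, z != v & a = c z].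
  case/imsetP=> z /setD1P[zu Xz] ->; exists z; split => //.
  by apply: contraNneq vX => <-.
have cv z : c z v = z by rewrite permM tpermR tpermL.
have cN z p : z != p -> p != u -> p != v -> c z p = p.
  by move=> zp pu pv; rewrite permM !tpermD // eq_sym.
have odd_c z : z != u -> ~~ odd_perm (c z).
  by move=> zu; rewrite odd_permM !odd_tperm uv eq_sym zu.
have gS : tperm u v \notin S.
  apply/negP => /inS[z [_ zu _ e]].
  by have := odd_c z zu; rewrite -e odd_tperm uv.
have xA : x \notin tperm u v |: S.
  rewrite !inE negb_or; apply/andP; split.
    by apply: contraNneq x_even => ->; rewrite odd_tperm uv.
  apply/negP => /inS[z [Xz zu zv ex]].
  have: z \in porbit x u by rewrite -(cv z) -ex perm_mem_porbit.
  by move/(transX _ _ Xu Xz)/eqP; rewrite (negPf zu).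
have cA : #|x |: (tperm u v |: S)| = (#|T| - cycle_defect x).+1.
  rewrite !cardsU1 xA gS card_in_imset; last first.
    by move=> z z' _ _ e; rewrite -(cv z) e cv.
  have := cycle_defect_porbits x; rewrite -cX (cardsD1 u X) Xu.
  by lia.
rewrite -cA; apply: irredundant_gen_iota; last by rewrite setU11.
- pose H := <<x |: (tperm u v |: S)>>%G.
  have Hx : x \in H by rewrite mem_gen // setU11.
  have Hg : tperm u v \in H by rewrite mem_gen // !inE eqxx orbT.
  have Hu z : z \in X -> tperm u z \in H.
    move=> Xz; have [->|zu] := eqVneq z u; first by rewrite tperm1 group1.
    rewrite -(groupMl _ Hg) mem_gen // !in_setU.
    by rewrite [_ \in S](imset_f c) ?orbT // !inE zu.
  apply: (@Sym_gen_transversal _ H _ _ _ Hx xf coverX) => z Xz.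
  have [->|zu] := eqVneq z u; first by rewrite tpermC Hu.
  have [->|zf] := eqVneq z f; first by rewrite tperm1 group1.
  have -> : tperm f z = tperm u z ^ tperm u f.
    by rewrite tpermJ tpermL tpermD // eq_sym.
  by rewrite groupJ ?Hu.
- move=> a /setU1P[->|/setU1P[->|/inS[z [Xz zu zv ->]]]].
  + apply: (@stab_gen_neq_Sym _ _ [set w] w f); rewrite ?inE //.
      by apply: contraNneq wX => <-.
    move=> b /setD1P[bx Ab] _ /set1P->; rewrite inE; apply/eqP.
    case/setU1P: Ab => [e|]; first by rewrite e eqxx in bx.
    case/setU1P=> [->|/inS[z [Xz _ _ ->]]]; first by rewrite tpermD // eq_sym.
    by rewrite cN //; apply: contraNneq wX => <-.
  (* Without (u v), all elements are even. *)
  + apply/negP => /eqP gen_even.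
    have: tperm u v \in 'Alt_T.
      have: <<(x |: (tperm u v |: S)) :\ tperm u v>> \subset 'Alt_T.
        rewrite gen_subG; apply/subsetP => b /setD1P[bg Ab]; rewrite Alt_even.
        case/setU1P: Ab => [-> //|].
        case/setU1P=> [e|/inS[z [_ zu _ ->]]]; last exact: odd_c.
        by rewrite e eqxx in bg.
      by rewrite gen_even => /subsetP; apply; rewrite inE.
    by rewrite Alt_even odd_tperm uv.
  + have neqC p : p \in porbit x u -> p \notin porbit x z.
      rewrite -!eq_porbit_mem => /eqP->; rewrite eq_porbit_mem.
      by apply: contra zu => /(transX _ _ Xz Xu) ->.
    apply: (@stab_gen_neq_Sym _ _ (porbit x z) z u); rewrite ?porbit_id //.
      by rewrite neqC ?porbit_id.
    move=> b /setD1P[bz Ab] p zp.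
    have pu : p != u by apply: contraTneq zp => ->; rewrite neqC ?porbit_id.
    have pv : p != v by apply: contraTneq zp => ->; rewrite neqC.
    case/setU1P: Ab => [->|]; first exact: perm_mem_porbit.
    case/setU1P=> [->|/inS[z' [Xz' zu' zv' eb]]].
      by rewrite tpermD // eq_sym.
    rewrite eb cN //; apply: contraNneq bz => e; rewrite eb.
    by rewrite -(transX z z') // e.
Qed.

(** * Elements of large irredundant generating sets *)

Lemma atrans_setT_sup (T : finType) (H G : {group {perm T}}) :
  H \subset G -> [transitive H, on [set: T] | 'P] ->
  [transitive G, on [set: T] | 'P].
Proof.
move=> sHG trH; rewrite (atrans_supgroup sHG trH).
by apply/actsP => a _ p; rewrite !inE.
Qed.

(** The second alternative comes from the sets A that contain an element g such
that A :\ g generates the alternating group; the count of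
[defect_transitive] then applies to A :\ g, and its bound on d(x) is weaker by one. *)
Lemma cycle_defect_iota_irr (T : finType) (k : nat) (x : {perm T}) :
  (1 < #|T|)%N -> (k < #|T|)%N ->
  (forall H : {group {perm T}}, [transitive H, on [set: T] | 'P] ->
     H :!=: 'Alt_T -> H :!=: 'Sym_T ->
     (max_irredundant_gen H + (k + 2) <= #|T|)%N) ->
  x \in iota_irr (#|T| - k) [set: {perm T}]%G ->
  (cycle_defect x <= k)%N \/
  [/\ ~~ odd_perm x, cycle_defect x = (k + 1)%N & odd k].
Proof.
move=> gt1T ltkT maxT; rewrite inE => /andP[_ /existsP[A]].
case/and3P=> /andP[irrA /eqP genA] /eqP cA Ax.
have /card_gt1P[i [j [_ _ ij]]] : (1 < #|[set: T]|)%N by rewrite cardsT.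
have neq_gen g : g \in A -> <<A :\ g>> != [set: {perm T}].
  by move=> Ag; have := forall_inP irrA g Ag; rewrite genA.
have trAlt g : g \in A -> [transitive <<A :\ g>>, on [set: T] | 'P] ->
    <<A :\ g>> = 'Alt_T.
  move=> Ag trg; apply/eqP; apply: contraT => neqAlt.
  have := maxT <<A :\ g>>%G trg neqAlt (neq_gen g Ag).
  have le_max : (#|A :\ g| <= max_irredundant_gen <<A :\ g>>%G)%N.
    apply: (@leq_bigmax_cond _ _ (fun B : {set {perm T}} => #|B|)).
    by rewrite /irredundant_gen eqxx irredundantD1.
  move: cA; rewrite (cardsD1 g A) Ag; lia.
have evenD g a : <<A :\ g>> = 'Alt_T -> a \in A -> a != g -> ~~ odd_perm a.
  by move=> eg Aa ag; rewrite -Alt_even -eg mem_gen // !inE ag.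
have trA : [transitive <<A>>, on [set: T] | 'P].
  rewrite genA; apply/imsetP; exists i => //; apply/esym/setP => p; rewrite inE.
  by apply/imsetP; exists (tperm i p); rewrite ?inE //= apermE tpermL.
have [noAlt|] := boolP [forall b in A, (b != x) ==>
     ~~ [transitive <<A :\ b>>, on [set: T] | 'P]].
  left; have ntr b : b \in A -> b != x -> ~~ [transitive <<A :\ b>>, on [set: T] | 'P].
    by move=> Ab bx; move: (forall_inP noAlt b Ab); rewrite bx.
  by have := defect_transitive Ax trA ntr; rewrite cA; lia.
case/forall_inPn=> g Ag; rewrite negb_imply negbK => /andP[gx trg].
have Altg := trAlt g Ag trg.
have x_even : ~~ odd_perm x by apply: (evenD g); rewrite // eq_sym.
have le_d : (cycle_defect x + #|A :\ g| <= #|T|)%N.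
  apply: defect_transitive trg _; first by rewrite !inE eq_sym gx.
  move=> b /setD1P[bg Ab] bx; apply/negP => trb.
  have trAb : [transitive <<A :\ b>>, on [set: T] | 'P].
    by apply: atrans_setT_sup trb; rewrite genS // setSD // subsetDl.
  (* Then A :\ b also generates the alternating group, and all of A is even. *)
  have g_even : ~~ odd_perm g by apply: (evenD b _ (trAlt b Ab trAb)); rewrite // eq_sym.
  have : [set: {perm T}] \subset 'Alt_T.
    rewrite -genA gen_subG; apply/subsetP => a Aa; rewrite Alt_even.
    by have [->|ag] := eqVneq a g; last exact: (evenD g).
  by move/subsetP/(_ (tperm i j)); rewrite Alt_even odd_tperm ij inE => /(_ isT).
have := cA; rewrite (cardsD1 g A) Ag => cAg.
have [|dk] := leqP (cycle_defect x) k; [by left | right].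
have d_k1 : cycle_defect x = (k + 1)%N by lia.
split=> //; have := odd_cycle_defect x; rewrite d_k1 (negPf x_even).
by rewrite addn1 /= => /negPn.
Qed.

Theorem corollary2 (Psi : nat -> nat)
  (Psi_gt0 : forall j : nat, 1 <= j <= 7 -> 0 < Psi j)
  (PsiP : forall j : nat, 1 <= j <= 7 ->
     forall n : nat, Psi j <= n ->
     forall H : {group 'S_n},
       [transitive H, on [set: 'I_n] | 'P] ->
       H :!=: ('Alt_('I_n))%g -> H :!=: ('Sym_('I_n))%g ->
       max_irredundant_gen H + j <= n)
  (k : nat) (k_range : 1 <= k <= 5)
  (n : nat) (n_ge : maxn (Psi (k + 2)) (3 * k + 3) <= n) :
  iota_irr (n - k) [set: 'S_n]%G =
    ([set x : 'S_n | cycle_defect x <= k]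
       :|: [set x : 'S_n | [&& ~~ odd_perm x, cycle_defect x == k + 1 & odd k]])
    :\ 1%g.
Proof.
have /andP[Psi_le n_ge3] : (Psi (k + 2) <= n) && (3 * k + 3 <= n) by rewrite -geq_max.
have cT := card_ord n.
have k2_range : 1 <= k + 2 <= 7 by lia.
have -> : n - k = #|'I_n| - k by rewrite cT.
apply/setP => x.
rewrite [in RHS]in_setD1 [in RHS]in_setU ![in RHS]in_set.
apply/idP/idP => [iota_x | /andP[x1 /orP[le_dk | /and3P[x_even /eqP dx _]]]].
- apply/andP; split.
    apply: contraTneq iota_x => ->; rewrite inE; apply/negP.
    case/andP=> _ /existsP[A /and3P[/andP[irrA _] _ A1]].
    by have := irredundant_notin1 irrA; rewrite A1.
  have : (cycle_defect x <= k) \/ [/\ ~~ odd_perm x, cycle_defect x = k + 1 & odd k].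
    apply: cycle_defect_iota_irr iota_x; rewrite cT; try lia.
    exact: PsiP.
  by case=> [-> // | [-> -> ->]]; rewrite eqxx orbT.
- by apply: iota_irr_defect_le => //; rewrite cT; lia.
- have := iota_irr_even x1 x_even; rewrite cT dx addn1.
  have -> : (n - k.+1).+1 = n - k by lia.
  by apply; lia.
Qed.
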